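(* Suppose that $F$ is globally Lipschitz continuous with modulus $L_F$. Let $\alpha>\tfrac12$, set $$c(\alpha):=\frac{2\alpha-1}{\alpha|2-\alpha|+\sqrt{\alpha^2(2-\alpha)^2+2(2\alpha-1)(2\alpha+1)^2}},$$ let $\gamma>0$ satisfy $\gamma L_F<c(\alpha)$, and let $(x^k)$ be generated from $x^{-1},x^0\in\mathbb R^n$ by $$x^{k+1}=\operatorname{prox}_{\gamma g}\Bigl(x^k-\gamma\bigl[(1+\alpha)F(x^k)-\alpha F(x^{k-1})\bigr]\Bigr),\qquad k=0,1,2,\dots$$ Then $(x^k)$ converges to a solution of $0\in F(x)+\partial g(x)$. Moreover, for any solution $x^\star$ and every $k\ge1$, $$\mathcal U^\alpha_{k+1}(x^\star)\le \mathcal U^\alpha_k(x^\star)-\gamma V_{k-1}(x^\star)-C\bigl(c(\alpha)^2-(\gamma L_F)^2\bigr)\|x^k-x^{k-1}\|^2,$$ where $C:=(1+2\alpha)^2+\dfrac{\alpha|2-\alpha|}{2c(\alpha)}>0$.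
   Context: Standing assumptions: $F:\mathbb R^n\to\mathbb R^n$ is monotone and locally Lipschitz continuous; $g:\mathbb R^n\to\mathbb R\cup\{+\infty\}$ is proper, convex and lower semicontinuous; the solution set $\operatorname{zer}T=\{x: 0\in Tx\}$, $Tx:=F(x)+\partial g(x)$, is nonempty. $\operatorname{prox}_{\gamma g}(y)=\arg\min_z\{g(z)+\frac1{2\gamma}\|z-y\|^2\}$. For $x\in\operatorname{dom}g$, $$V_k(x):=g(x^k)-g(x)-\langle F(x^k),x-x^k\rangle,$$ $$\mathcal U^\alpha_k(x):=\tfrac12\|x^k-x\|^2+\tfrac12\|x^k-x^{k-1}\|^2+\tfrac{\lambda\gamma^2}{2}\|F(x^{k-1})-F(x^{k-2})\|^2+(1+\alpha)\gamma V_{k-1}(x),$$ with $$\lambda=2\alpha^2\Bigl(1+\frac{|2-\alpha|}{2\alpha\,c(\alpha)}+\frac{1+\alpha}{\alpha}\Bigr).$$ One has $V_k(x^\star)\ge0$ for every solution $x^\star$. The quantity $V_0(x^\star)$ may be $+\infty$ if $x^0\notin\operatorname{dom} g$; the descent inequality is then understood with all subtracted (nonnegative) terms moved to the left-hand side. *)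

(* Defs.v *)
From HB Require Import structures.
From mathcomp Require Import all_boot all_order all_algebra.
From mathcomp Require Import all_classical all_reals all_analysis.

Set Implicit Arguments.
Unset Strict Implicit.
Unset Printing Implicit Defensive.

Import Order.TTheory GRing.Theory Num.Theory.
Import numFieldNormedType.Exports.

Local Open Scope classical_set_scope.
Local Open Scope ring_scope.

(* The library norm `|u| on 'rV[R]_n is the sup norm; it induces the usual
   topology of R^n, but the quantitative statements need the Euclidean norm. *)

Definition dotv (R : realType) (n : nat) (u v : 'rV[R]_n) : R :=
  \sum_(i < n) u 0 i * v 0 i.

Definition enorm (R : realType) (n : nat) (u : 'rV[R]_n) : R :=
  Num.sqrt (dotv u u).

Definition monotone_op (R : realType) (n : nat) (F : 'rV[R]_n -> 'rV[R]_n) :=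
  forall x y, 0 <= dotv (F x - F y) (x - y).

Definition enorm_lipschitz (R : realType) (n : nat) (L : R)
    (F : 'rV[R]_n -> 'rV[R]_n) :=
  forall x y, enorm (F x - F y) <= L * enorm (x - y).

Definition edom (R : realType) (T : Type) (g : T -> \bar R) : set T :=
  [set x | (g x < +oo)%E].

Definition proper_fun (R : realType) (T : Type) (g : T -> \bar R) :=
  (forall x, (-oo < g x)%E) /\ edom g !=set0.

Definition econvex (R : realType) (n : nat) (g : 'rV[R]_n -> \bar R) :=
  forall (t : R) (x y : 'rV[R]_n), 0 < t < 1 ->
    (g (t *: x + (1 - t) *: y)%R <= t%:E * g x + (1 - t)%:E * g y)%E.

Definition subdiff (R : realType) (n : nat) (g : 'rV[R]_n -> \bar R)
    (x : 'rV[R]_n) : set 'rV[R]_n :=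
  [set v | forall y, (g x + (dotv v (y - x))%:E <= g y)%E].

Definition opT (R : realType) (n : nat) (F : 'rV[R]_n -> 'rV[R]_n)
    (g : 'rV[R]_n -> \bar R) (x : 'rV[R]_n) : set 'rV[R]_n :=
  [set F x + v | v in subdiff g x].

Definition zer (R : realType) (n : nat) (T : 'rV[R]_n -> set 'rV[R]_n) :
    set 'rV[R]_n := [set x | T x 0].

Definition argmin (R : realType) (T : Type) (h : T -> \bar R) : set T :=
  [set z | forall w, (h z <= h w)%E].

(* For g proper, convex, lower semicontinuous and gamma > 0 the argmin is a
   singleton, and get returns its element. *)
Definition prox (R : realType) (n : nat) (gamma : R) (g : 'rV[R]_n -> \bar R)
    (y : 'rV[R]_n) : 'rV[R]_n :=
  get (argmin (fun z => (g z + ((2 * gamma)^-1 * enorm (z - y) ^+ 2)%:E)%E)).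

(* The iterates are indexed by int, so that x (-1) is the extra starting point;
   values at indices below -1 play no role. *)
Section Quantities.
Context (R : realType) (n : nat).
Context (F : 'rV[R]_n -> 'rV[R]_n) (g : 'rV[R]_n -> \bar R).
Context (alpha gamma : R) (x : int -> 'rV[R]_n).

Definition c_alpha : R :=
  (2 * alpha - 1) /
  (alpha * `|2 - alpha| +
   Num.sqrt (alpha ^+ 2 * (2 - alpha) ^+ 2 +
             2 * (2 * alpha - 1) * (2 * alpha + 1) ^+ 2)).

Definition lambda_alpha : R :=
  2 * alpha ^+ 2 *
  (1 + `|2 - alpha| / (2 * alpha * c_alpha) + (1 + alpha) / alpha).

Definition C_alpha : R :=
  (1 + 2 * alpha) ^+ 2 + alpha * `|2 - alpha| / (2 * c_alpha).

(* Extended-real valued: equal to +oo when x k is outside dom g (which can only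
   happen for the starting points) and p is in dom g. *)
Definition V (k : int) (p : 'rV[R]_n) : \bar R :=
  (g (x k) - g p - (dotv (F (x k)) (p - x k))%:E)%E.

Definition U (k : int) (p : 'rV[R]_n) : \bar R :=
  ((2^-1 * enorm (x k - p) ^+ 2
    + 2^-1 * enorm (x k - x (k - 1)) ^+ 2
    + lambda_alpha * gamma ^+ 2 / 2 *
        enorm (F (x (k - 1)) - F (x (k - 2))) ^+ 2)%:E
   + ((1 + alpha) * gamma)%:E * V (k - 1)%R p)%E.

End Quantities.

(* Main.v *)
(* Write d = x^k - x^(k-1), e = x^(k+1) - x^k, A and B for the increments
   F x^k - F x^(k-1) and F x^(k-1) - F x^(k-2), and s_k for the subgradient of g
   at x^k produced by the prox step. The descent inequality is the subgradient
   inequality for s_(k+1) at the solution, plus the one for s_k at x^(k+1), plus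
   alpha times the one for s_k at x^(k-1). The remaining term - <w, e>, with
   w = d - gamma ((1 + alpha) A - alpha B), is at least - |w|^2, because
   monotonicity of the subdifferential gives |e|^2 <= <w, e>. Expanding |w|^2,
   dropping <A, d> >= 0 and splitting <B, d> and <A, B> by Young's inequality
   leaves a quadratic condition whose positive root is c(alpha).
   The iterates are then bounded, and their increments and the gaps V_k vanish.
   An ultrafilter limit q of the sequence is a solution by lower semicontinuity,
   and the Lyapunov function at q is nonincreasing with limit 0 along the
   ultrafilter, hence tends to 0. *)

Require Import Defs.
From HB Require Import structures.
From mathcomp Require Import all_boot all_order all_algebra.
From mathcomp Require Import all_classical all_reals all_analysis.
From mathcomp Require Import ring lra.

Set Implicit Arguments.
Unset Strict Implicit.
Unset Printing Implicit Defensive.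

Import Order.TTheory GRing.Theory Num.Theory.
Import numFieldNormedType.Exports.

Local Open Scope classical_set_scope.
Local Open Scope ring_scope.

(** * Euclidean inner product, Young's inequality and limits *)

Lemma dotvC (R : realType) (n : nat) (u v : 'rV[R]_n) : dotv u v = dotv v u.
Proof. by apply: eq_bigr => i _; rewrite mulrC. Qed.

Lemma dotvDl (R : realType) (n : nat) (u v w : 'rV[R]_n) :
  dotv (u + v) w = dotv u w + dotv v w.
Proof. by rewrite -big_split; apply: eq_bigr => i _; rewrite mxE mulrDl. Qed.

Lemma dotvDr (R : realType) (n : nat) (u v w : 'rV[R]_n) :
  dotv u (v + w) = dotv u v + dotv u w.
Proof. by rewrite !(dotvC u) dotvDl. Qed.

Lemma dotvZl (R : realType) (n : nat) (a : R) (u v : 'rV[R]_n) :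
  dotv (a *: u) v = a * dotv u v.
Proof. by rewrite mulr_sumr; apply: eq_bigr => i _; rewrite mxE mulrA. Qed.

Lemma dotvZr (R : realType) (n : nat) (a : R) (u v : 'rV[R]_n) :
  dotv u (a *: v) = a * dotv u v.
Proof. by rewrite dotvC dotvZl dotvC. Qed.

Lemma dotvNl (R : realType) (n : nat) (u v : 'rV[R]_n) :
  dotv (- u) v = - dotv u v.
Proof. by rewrite -scaleN1r dotvZl mulN1r. Qed.

Lemma dotvNr (R : realType) (n : nat) (u v : 'rV[R]_n) :
  dotv u (- v) = - dotv u v.
Proof. by rewrite dotvC dotvNl dotvC. Qed.

Definition dotvE := (dotvDl, dotvDr, dotvNl, dotvNr, dotvZl, dotvZr).

Lemma dotvv_ge0 (R : realType) (n : nat) (u : 'rV[R]_n) : 0 <= dotv u u.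
Proof. by apply: sumr_ge0 => i _; rewrite -expr2 sqr_ge0. Qed.

Lemma enorm_ge0 (R : realType) (n : nat) (u : 'rV[R]_n) : 0 <= enorm u.
Proof. exact: sqrtr_ge0. Qed.

Lemma enorm_sqr (R : realType) (n : nat) (u : 'rV[R]_n) :
  enorm u ^+ 2 = dotv u u.
Proof. by rewrite sqr_sqrtr ?dotvv_ge0. Qed.

(** Expand [|s u - v|^2 >= 0] and divide by [s]. *)
Lemma dotv_young (R : realType) (n : nat) (s : R) (u v : 'rV[R]_n) : 0 < s ->
  2 * dotv u v <= s * dotv u u + s^-1 * dotv v v.
Proof.
move=> s0; have sE : s^-1 * s = 1 by rewrite mulVf ?gt_eqF.
have := dotvv_ge0 (s *: u - v); rewrite !dotvE (dotvC v u) => h.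
have {h} : 0 <= s^-1 * (s * (s * dotv u u) + - (s * dotv u v)
    + (- (s * dotv u v) - - dotv v v)).
  by apply: mulr_ge0; [rewrite invr_ge0 ltW|lra].
suff -> : s^-1 * (s * (s * dotv u u) + - (s * dotv u v)
    + (- (s * dotv u v) - - dotv v v)) =
  (s^-1 * s) * (s * dotv u u) - 2 * (s^-1 * s) * dotv u v + s^-1 * dotv v v.
  by rewrite sE; lra.
by ring.
Qed.

(** Bridge between the sup norm, which carries the topology, and the Euclidean norm of the
    estimates. *)
Lemma normr_le_enorm (R : realType) (n : nat) (u : 'rV[R]_n) : `|u| <= enorm u.
Proof.
rewrite [`|u|]mx_normrE; apply: bigmax_le => [|[i j] _ /=]; first exact: enorm_ge0.
rewrite (ord1 i) -(@ler_pXn2r _ 2) ?nnegrE ?enorm_ge0//.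
rewrite enorm_sqr real_normK ?num_real// /dotv (bigD1 j) //= -expr2 lerDl.
by apply: sumr_ge0 => k _; rewrite -expr2 sqr_ge0.
Qed.

Lemma cvg_dotv (R : realType) (n : nat) (T : Type) (G : set_system T)
    {FG : ProperFilter G} (u v : T -> 'rV[R]_n) (a b : 'rV[R]_n) :
  u @ G --> a -> v @ G --> b -> (fun t => dotv (u t) (v t)) @ G --> dotv a b.
Proof.
move=> ua vb; apply: cvg_big => [|i _]; first exact: add_continuous.
apply: cvgM.
  exact: (cvg_comp _ _ ua (@coord_continuous _ _ _ 0 i a)).
exact: (cvg_comp _ _ vb (@coord_continuous _ _ _ 0 i b)).
Qed.

Lemma cvg_dotv0 (R : realType) (n : nat) (T : Type) (G : set_system T)
    {FG : ProperFilter G} (u : T -> 'rV[R]_n) :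
  (fun t => dotv (u t) (u t)) @ G --> (0 : R) -> u @ G --> (0 : 'rV[R]_n).
Proof.
move=> u0; apply/cvgr0Pnorm_lt => e e0; near=> t.
apply: le_lt_trans (normr_le_enorm _) _.
rewrite -(@ltr_pXn2r _ 2) ?nnegrE ?enorm_ge0 ?ltW// enorm_sqr.
rewrite -(ger0_norm (dotvv_ge0 (u t))); near: t.
by move/cvgr0Pnorm_lt : u0; apply; rewrite exprn_gt0.
Unshelve. all: by end_near. Qed.

Lemma cvg0_dotv (R : realType) (n : nat) (T : Type) (G : set_system T)
    {FG : ProperFilter G} (u : T -> 'rV[R]_n) :
  u @ G --> (0 : 'rV[R]_n) -> (fun t => dotv (u t) (u t)) @ G --> (0 : R).
Proof.
move=> u0; have := cvg_dotv u0 u0.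
suff -> : @dotv R n 0 0 = 0 by exact.
by rewrite /dotv big1// => i _; rewrite mxE mul0r.
Qed.

(** * Compactness by ultrafilters and lower semicontinuity along a filter *)

Lemma fmap_ultra (T U : Type) (f : T -> U) (G : set_system T) :
  UltraFilter G -> UltraFilter (f @ G).
Proof.
move=> UG; split=> [|H HF fGH]; first exact: fmap_proper_filter.
apply/seteqP; split=> // B HB.
have [//|GC] := in_ultra_setVsetC (f @^-1` B) UG.
by have [u []] := @filter_ex _ _ HF _ (filterI HB (fGH (~` B) GC)).
Qed.

(** Replaces the extraction of a subsequence: since [G] refines [\oo], every limit along [\oo] is
    also one along [G]. *)
Lemma bounded_ultra_cvg (R : realType) (n : nat) (w : nat -> 'rV[R]_n) (M : R) :
  (forall k, `|w k| <= M) ->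
  exists (G : set_system nat) (q : 'rV[R]_n),
    [/\ ProperFilter G, \oo `<=` G & w @ G --> q].
Proof.
move=> wM.
have [G [UG ooG]] : exists G, UltraFilter G /\ \oo `<=` G.
  exact: ultraFilterLemma.
have : compact (closed_ball_ (fun x => `|x|) (0 : 'rV[R]_n) M).
  apply: bounded_closed_compact; last exact: closed_closed_ball_.
  exists M; split; first by rewrite num_real.
  move=> r Mr u /=; rewrite /closed_ball_ /= sub0r normrN => /le_trans.
  by apply; exact: ltW.
rewrite compact_ultra => /(_ (w @ G)) [].
- exact: fmap_ultra.
- by apply: (@filterE _ G) => k /=; rewrite /closed_ball_ /= sub0r normrN.
move=> q [_ wq]; exists G, q; split => //; exact: ultra_proper.
Qed.

(** Otherwise a real [a] strictly between [l] and [g q] would eventually lie below [g (w t)] and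
    above [b t]. *)
Lemma lsc_le_lim (R : realType) (X : topologicalType) (T : Type)
    (G : set_system T) (FG : ProperFilter G) (g : X -> \bar R)
    (w : T -> X) (q : X) (b : T -> R) (l : R) :
  lower_semicontinuous g -> w @ G --> q -> b @ G --> l ->
  (\forall t \near G, (g (w t) <= (b t)%:E)%E) -> (g q <= l%:E)%E.
Proof.
move=> glsc wq bl gb; rewrite leNgt; apply/negP => lq.
have [a la aq] : exists2 a : R, l < a & (a%:E < g q)%E.
  case gqE : (g q) lq => [r| |] //.
  - rewrite lte_fin => lr; exists ((l + r) / 2); rewrite ?lte_fin; lra.
  - by move=> _; exists (l + 1); [lra|exact: ltry].
have [W qW Wg] := glsc q a aq.
have gW : \forall t \near G, W (w t) by apply: wq.
have ba : \forall t \near G, b t < a by move: bl => /cvgr_lt; apply.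
have [t [[Wt bt] gt]] := @filter_ex _ _ FG _ (filterI (filterI gW ba) gb).
have := lt_le_trans (Wg _ Wt) gt; rewrite lte_fin; lra.
Qed.

(** * Subgradients and the proximal map *)

Lemma subdiff_fin_num (R : realType) (n : nat) (g : 'rV[R]_n -> \bar R)
    (z v : 'rV[R]_n) :
  proper_fun g -> subdiff g z v -> g z \is a fin_num.
Proof.
move=> [gNy [y]]; rewrite /edom/= => gy zv; have := zv y; have := gNy z.
by case: (g z) => //; rewrite addye // leye_eq => _ /eqP gyE; rewrite gyE in gy.
Qed.

(* A subgradient gives an affine minorant of [g], whence coercivity. *)
Lemma argmin_prox_neq0 (R : realType) (n : nat) (gamma : R)
    (g : 'rV[R]_n -> \bar R) (y z v : 'rV[R]_n) :
  0 < gamma -> proper_fun g -> lower_semicontinuous g -> subdiff g z v ->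
  argmin (fun w => (g w + ((2 * gamma)^-1 * enorm (w - y) ^+ 2)%:E)%E) !=set0.
Proof.
move=> gamma0 gp glsc zv; have gzfin := subdiff_fin_num gp zv.
have [gNy [p]] := gp; rewrite /edom/= => gpy.
pose Q w := (2 * gamma)^-1 * dotv (w - y) (w - y).
pose h w := (g w + (Q w)%:E)%E.
have hE : (fun w => (g w + ((2 * gamma)^-1 * enorm (w - y) ^+ 2)%:E)%E) = h.
  by apply/funext => w; rewrite enorm_sqr.
rewrite hE.
(* Young's inequality with weight [(2 * gamma)^-1] absorbs [dotv v (w - y)] into half of the
   quadratic term; the other half gives coercivity. *)
pose c := fine (g z) + dotv v (y - z) - gamma * dotv v v.
have hge w : ((c + (4 * gamma)^-1 * dotv (w - y) (w - y))%:E <= h w)%E.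
  have := zv w; rewrite -(fineK gzfin) /h -EFinD => zw.
  apply: le_trans (leeD2r _ zw); rewrite -EFinD lee_fin /c /Q.
  have s0 : 0 < (2 * gamma)^-1 by rewrite invr_gt0; lra.
  have := dotv_young (- (w - y)) v s0; rewrite invrK !dotvE !(dotvC v).
  have -> : (4 * gamma)^-1 = (2 * gamma)^-1 / 2 by field; lra.
  lra.
pose S := [set r : R | exists w, h w = r%:E].
have S0 : has_inf S.
  split.
    exists (fine (g p) + Q p), p; rewrite /h EFinD fineK // fin_numElt gNy.
    exact: gpy.
  exists c => r [w hw]; have := hge w; rewrite hw lee_fin; apply: le_trans.
  by rewrite lerDl mulr_ge0 ?dotvv_ge0// invr_ge0; lra.
have Sinf w : ((inf S)%:E <= h w)%E.
  case hw : (h w) => [r| |]; [|exact: leey|].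
    by rewrite lee_fin; apply: ge_inf; [exact: S0.2|exists w].
  by have := hge w; rewrite hw.
(* A minimizing sequence; [hge] bounds it, as [h (w k) <= inf S + 1]. *)
have /choice[w wP] : forall k : nat, exists w, (h w <= (inf S + k.+1%:R^-1)%:E)%E.
  move=> k; have [|r [w hw] rlt] := @inf_adherent _ S k.+1%:R^-1 _ S0.
    by rewrite invr_gt0.
  by exists w; rewrite hw lee_fin ltW.
pose D := 4 * gamma * (inf S + 1 - c).
have wD k : dotv (w k - y) (w k - y) <= D.
  have := le_trans (hge (w k)) (wP k); rewrite lee_fin => hk.
  have k1 : k.+1%:R^-1 <= 1 :> R by rewrite invf_le1 ?ltr0n// ler1n.
  rewrite /D mulrC -ler_pdivrMr; last lra.
  rewrite mulrC -(lerD2l c); apply: (le_trans hk).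
  by rewrite addrC [c + _]addrC subrK addrC lerD2l.
have wb k : `|w k| <= Num.sqrt D + `|y|.
  rewrite -[w k](subrK y); apply: le_trans (ler_normD _ _) _; rewrite lerD2r.
  by apply: le_trans (normr_le_enorm _) _; rewrite /enorm ler_wsqrtr.
have [G [q [FG ooG wq]]] := bounded_ultra_cvg wb.
exists q => t; apply: le_trans (Sinf t).
rewrite -leeBrDr //.
(* The quadratic term is continuous, so it goes into the bound and semicontinuity is applied to [g]
   alone. *)
pose b k := inf S + k.+1%:R^-1 - Q (w k).
apply: (@lsc_le_lim _ _ _ G _ g w q b) => //.
  apply: cvgB.
    rewrite -[X in _ --> X]addr0; apply: cvgD; first exact: cvg_cst.
    exact: cvg_trans (cvg_app _ ooG) (cvg_harmonic).
  apply: cvgM; first exact: cvg_cst.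
  by apply: cvg_dotv; apply: cvgB => //; exact: cvg_cst.
by apply: filterE => k; rewrite /b EFinB leeBrDr //; exact: wP.
Qed.

(** Fermat's rule: the minimizer [z] is compared with the points [t w + (1 - t) z] of a segment, for
    small [t]. The subgradient [vs] at [xs] ensures that the minimum is attained. *)
Lemma prox_subdiff (R : realType) (n : nat) (gamma : R)
    (g : 'rV[R]_n -> \bar R) (y xs vs : 'rV[R]_n) :
  0 < gamma -> proper_fun g -> econvex g -> lower_semicontinuous g ->
  subdiff g xs vs ->
  subdiff g (prox gamma g y) (gamma^-1 *: (y - prox gamma g y)).
Proof.
move=> gamma0 gp gcvx glsc xsvs w.
have /getPex := argmin_prox_neq0 y gamma0 gp glsc xsvs.
rewrite -/(prox gamma g y); set z := prox gamma g y => zmin.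
have [gNy [p]] := gp; rewrite /edom/= => gpy.
have zfin : g z \is a fin_num.
  have := zmin p; have := gNy z; case: (g z) => //= _.
  by rewrite addye // leye_eq; case: (g p) gpy.
case gw : (g w) => [r| |]; [|exact: leey|by have := gNy w; rewrite gw].
rewrite -(fineK zfin) -EFinD lee_fin.
set m := fine (g z).
set K := gamma^-1.
have K0 : 0 < K by rewrite invr_gt0.
have key t : 0 < t < 1 ->
    m - r + K * dotv (y - z) (w - z) <= t * (K / 2 * dotv (w - z) (w - z)).
  move=> t01; have /andP[t0 t1] := t01.
  have := le_trans (zmin (t *: w + (1 - t) *: z)) (leeD2r _ (gcvx t w z t01)).
  rewrite gw -(fineK zfin) -!EFinM -!EFinD lee_fin !enorm_sqr -/m.
  have -> : t *: w + (1 - t) *: z - y = (z - y) + t *: (w - z).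
    by rewrite scalerBl scale1r scalerBr; apply/rowP => i; rewrite !mxE; ring.
  have -> : (2 * gamma)^-1 = K / 2 by rewrite /K; field; lra.
  have -> : dotv (y - z) (w - z) = - dotv (z - y) (w - z).
    by rewrite -dotvNl opprB.
  rewrite (dotvDl (z - y)) !(dotvDr _ (z - y)) !dotvZl !dotvZr.
  rewrite (dotvC (w - z) (z - y)) => h.
  by rewrite -(ler_pM2l t0); nra.
have {}key : m - r + K * dotv (y - z) (w - z) <= 0.
  set Z := K / 2 * dotv (w - z) (w - z) in key.
  have Z0 : 0 <= Z by rewrite !mulr_ge0 ?dotvv_ge0 ?invr_ge0; lra.
  rewrite leNgt; apply/negP; set X := (X in 0 < X) => X0.
  have D0 : 0 < X + Z + 1 by lra.
  (* Instead of a limit [t -> 0], one value suffices: [X <= t Z] at this [t] would give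
     [X + Z + 1 <= Z]. *)
  have := key (X / (X + Z + 1)); rewrite divr_gt0// ltr_pdivrMr// mul1r.
  rewrite -/X mulrAC ler_pdivlMr// => /(_ _); nra.
by rewrite !dotvZl; lra.
Qed.

(** * The constants and the one-step descent inequality *)

Lemma c_alpha_gt0 (R : realType) (alpha : R) : 2^-1 < alpha -> 0 < c_alpha alpha.
Proof.
move=> a2; apply: divr_gt0; first lra.
apply: ltr_wpDl; first by rewrite mulr_ge0 ?normr_ge0//; lra.
rewrite sqrtr_gt0; apply: ltr_wpDl; first by rewrite mulr_ge0 ?sqr_ge0.
by rewrite !mulr_gt0 ?exprn_gt0//; lra.
Qed.

(** [c_alpha] is the positive root of this quadratic, with the square root moved to the
    denominator. *)
Lemma c_alpha_quadratic (R : realType) (alpha : R) : 2^-1 < alpha ->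
  (1 + 2 * alpha) ^+ 2 * c_alpha alpha ^+ 2
  + alpha * `|2 - alpha| * c_alpha alpha = alpha - 2^-1.
Proof.
move=> a2; rewrite /c_alpha.
set b := `|2 - alpha|.
set D := alpha ^+ 2 * _ + _.
have b2 : b ^+ 2 = (2 - alpha) ^+ 2 by rewrite real_normK ?num_real.
have D0 : 0 < D.
  apply: ltr_wpDl; first by rewrite mulr_ge0 ?sqr_ge0.
  by rewrite !mulr_gt0 ?exprn_gt0//; lra.
have sD : Num.sqrt D ^+ 2 = D by rewrite sqr_sqrtr ?ltW.
have s0 : 0 < Num.sqrt D by rewrite sqrtr_gt0.
have b0 : 0 <= b by rewrite normr_ge0.
set s := Num.sqrt D in sD s0 *.
have ab0 : 0 <= alpha * b by rewrite mulr_ge0//; lra.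
have q0 : alpha * b + s != 0 by rewrite gt_eqF//; lra.
have sE : s ^+ 2 = alpha ^+ 2 * b ^+ 2 + 2 * (2 * alpha - 1) * (2 * alpha + 1) ^+ 2.
  by rewrite sD b2.
have key : 2 * (1 + 2 * alpha) ^+ 2 * (2 * alpha - 1)
    = s ^+ 2 - alpha ^+ 2 * b ^+ 2 by rewrite sE; ring.
(* By [key] the bracket is [(s - alpha b)(s + alpha b)], which cancels one factor of the
   denominator. *)
have -> : (1 + 2 * alpha) ^+ 2 * ((2 * alpha - 1) / (alpha * b + s)) ^+ 2
  = (2 * (1 + 2 * alpha) ^+ 2 * (2 * alpha - 1)) * (2 * alpha - 1) / 2
     / (alpha * b + s) ^+ 2 by field.
by rewrite key; field.
Qed.

Lemma C_alpha_gt0 (R : realType) (alpha : R) : 2^-1 < alpha -> 0 < C_alpha alpha.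
Proof.
rewrite /C_alpha => a2; move: (c_alpha alpha) (c_alpha_gt0 a2) => c c0.
apply: ltr_wpDr; last by rewrite exprn_gt0//; lra.
by rewrite divr_ge0 ?mulr_ge0 ?normr_ge0//; lra.
Qed.

(** The coefficient left to [|d|^2] in the descent: [alpha - 2^-1] less what Young's inequality for
    [dotv B d] costs. *)
Lemma C_alpha_c_sqr (R : realType) (alpha : R) : 2^-1 < alpha ->
  C_alpha alpha * c_alpha alpha ^+ 2
  = alpha - 2^-1 - alpha * `|2 - alpha| * c_alpha alpha / 2.
Proof.
move=> a2; rewrite -(c_alpha_quadratic a2) /C_alpha.
by have c0 := c_alpha_gt0 a2; field; rewrite gt_eqF.
Qed.

(** With this value the Lyapunov term in [|A|^2] and the [(1 + alpha)(1 + 2 alpha) gamma^2 |A|^2]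
    coming from [|w|^2] add up to [C_alpha gamma^2 |A|^2], which the Lipschitz bound turns into a
    multiple of [|d|^2]. *)
Lemma lambda_alphaE (R : realType) (alpha : R) : 2^-1 < alpha ->
  lambda_alpha alpha = 2 * (C_alpha alpha - (1 + alpha) * (1 + 2 * alpha)).
Proof.
move=> a2; rewrite /lambda_alpha /C_alpha.
by have c0 := c_alpha_gt0 a2; field; rewrite !gt_eqF//; lra.
Qed.

Lemma lambda_alpha_ge0 (R : realType) (alpha : R) : 2^-1 < alpha ->
  0 <= lambda_alpha alpha.
Proof.
rewrite /lambda_alpha => a2; move: (c_alpha alpha) (c_alpha_gt0 a2) => c c0.
apply: mulr_ge0; first by rewrite mulr_ge0 ?sqr_ge0.
by rewrite !addr_ge0// divr_ge0 ?mulr_ge0 ?normr_ge0//; lra.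
Qed.

(* Everything is expressed through the increments [d], [e] of the iterates and
   [A], [B] of the values of [F]; [f] stands for [F x^k] and [u] for [x^k - p]. *)
Lemma descent_increments (R : realType) (n : nat) (alpha gamma L : R)
    (u d e f A B : 'rV[R]_n) (g2 g3 gp g1 : R) :
  2^-1 < alpha -> 0 < gamma ->
  g3 + dotv (- (gamma^-1 *: e) - ((1 + alpha) *: f - alpha *: (f - A)))
            (- (u + e)) <= gp ->
  g2 + dotv (- (gamma^-1 *: d)
             - ((1 + alpha) *: (f - A) - alpha *: (f - A - B))) e <= g3 ->
  g2 + dotv (- (gamma^-1 *: d)
             - ((1 + alpha) *: (f - A) - alpha *: (f - A - B))) (- d) <= g1 ->
  g3 + dotv (- (gamma^-1 *: e) - ((1 + alpha) *: f - alpha *: (f - A)))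
            (- e) <= g2 ->
  0 <= dotv A d -> dotv A A <= L ^+ 2 * dotv d d ->
  2^-1 * dotv (u + e) (u + e) + 2^-1 * dotv e e
  + lambda_alpha alpha * gamma ^+ 2 / 2 * dotv A A
  + (1 + alpha) * gamma * (g2 - gp + dotv f u)
  + gamma * (g1 - gp + dotv (f - A) (u - d))
  + C_alpha alpha * (c_alpha alpha ^+ 2 - (gamma * L) ^+ 2) * dotv d d
  <= 2^-1 * dotv u u + 2^-1 * dotv d d
     + lambda_alpha alpha * gamma ^+ 2 / 2 * dotv B B
     + (1 + alpha) * gamma * (g1 - gp + dotv (f - A) (u - d)).
Proof.
move=> a2 g0 H1 H2 H3 H4 Ad AAd.
have gi : gamma * gamma^-1 = 1 by rewrite mulfV ?gt_eqF.
have c0 := c_alpha_gt0 a2.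
have C0 := C_alpha_gt0 a2.
pose y1 := f + alpha *: A; pose y0 := f - A + alpha *: B.
have y1E : (1 + alpha) *: f - alpha *: (f - A) = y1.
  by apply/rowP => i; rewrite !mxE; ring.
have y0E : (1 + alpha) *: (f - A) - alpha *: (f - A - B) = y0.
  by apply/rowP => i; rewrite !mxE; ring.
rewrite y1E in H1 H4; rewrite y0E in H2 H3.
have scale_ineq a b (s v w : 'rV[R]_n) :
    a + dotv (- (gamma^-1 *: v) - s) w <= b ->
    gamma * a - dotv v w - gamma * dotv s w <= gamma * b.
  rewrite -(ler_pM2l g0) mulrDr dotvDl !dotvNl dotvZl mulrBr mulrN mulrA gi.
  by rewrite mul1r addrA.
move: H1 => /scale_ineq H1; move: H2 => /scale_ineq H2.
move: H3 => /scale_ineq H3; move: H4 => /scale_ineq H4.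
pose w := d - gamma *: ((1 + alpha) *: A - alpha *: B).
have H5 := dotvv_ge0 (w - e).
have H6 := dotvv_ge0 (A + B).
(* Young's inequality with weight [c_alpha]; the sign of [2 - alpha] decides whether [d] is paired
   with [gamma B] or [- gamma B]. *)
have H7 : 2 * (alpha * (2 - alpha) * gamma * dotv B d) <=
    alpha * `|2 - alpha| * (c_alpha alpha * dotv d d
                            + (c_alpha alpha)^-1 * gamma ^+ 2 * dotv B B).
  have : 0 <= alpha * `|2 - alpha| by rewrite mulr_ge0 ?normr_ge0//; lra.
  have [b2|b2] := ger0P (2 - alpha) => b0.
    have := dotv_young d (gamma *: B) c0; rewrite !dotvE (dotvC d B) => h.
    by have := ler_wpM2l b0 h; lra.
  have := dotv_young d (- (gamma *: B)) c0; rewrite !dotvE (dotvC d B) => h.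
  by have := ler_wpM2l b0 h; lra.
have H8 : alpha * `|2 - alpha| * (c_alpha alpha)^-1
    = 2 * (C_alpha alpha - (1 + 2 * alpha) ^+ 2).
  by rewrite /C_alpha; move: (c_alpha alpha) c0 => c c0; field; rewrite gt_eqF.
have H9 := C_alpha_c_sqr a2.
have alpha0 : 0 <= alpha by lra.
have {}H3 := ler_wpM2l alpha0 H3.
have {}H6 : 0 <= alpha * (1 + alpha) * gamma ^+ 2 * dotv (A + B) (A + B).
  by rewrite !mulr_ge0 ?sqr_ge0//; lra.
have {}Ad : 0 <= 2 * gamma * (1 + alpha) * dotv A d.
  by rewrite !mulr_ge0//; lra.
have {}AAd := ler_wpM2l (mulr_ge0 (sqr_ge0 gamma) (ltW C0)) AAd.
have {H7}: 2 * (alpha * (2 - alpha) * gamma * dotv B d) <=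
    alpha * `|2 - alpha| * c_alpha alpha * dotv d d
     + 2 * (C_alpha alpha - (1 + 2 * alpha) ^+ 2) * gamma ^+ 2 * dotv B B.
  by rewrite -H8; lra.
have -> : alpha * `|2 - alpha| * c_alpha alpha
    = 2 * (alpha - 2^-1 - C_alpha alpha * c_alpha alpha ^+ 2) by lra.
rewrite (lambda_alphaE a2) => H7.
(* [H2] enters twice: once with [H1] and [H3], and once with [H4], which gives [|e|^2 <= <w, e>] and
   then, by [H5], [<w, e> <= |w|^2]. *)
move: H1 H2 H3 H4 H5 H6 H7 Ad AAd; rewrite /w /y1 /y0 !dotvE.
rewrite !(dotvC e) !(dotvC d A) !(dotvC d B) !(dotvC B A).
clear -alpha; move: (C_alpha alpha) (c_alpha alpha) => C c.
lra.
Qed.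

(** Real form of [V]; faithful only where [g] is finite, since [fine] sends infinite values to 0. *)
Definition gap (R : realType) (n : nat) (F : 'rV[R]_n -> 'rV[R]_n)
    (g : 'rV[R]_n -> \bar R) (a p : 'rV[R]_n) : R :=
  fine (g a) - fine (g p) - dotv (F a) (p - a).

(* The real-valued form of [U], with [a0], [a1], [a2] three consecutive iterates. *)
Definition lyapunov (R : realType) (n : nat) (F : 'rV[R]_n -> 'rV[R]_n)
    (g : 'rV[R]_n -> \bar R) (alpha gamma : R) (a0 a1 a2 p : 'rV[R]_n) : R :=
  2^-1 * dotv (a2 - p) (a2 - p) + 2^-1 * dotv (a2 - a1) (a2 - a1)
  + lambda_alpha alpha * gamma ^+ 2 / 2 * dotv (F a1 - F a0) (F a1 - F a0)
  + (1 + alpha) * gamma * gap F g a1 p.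

(** The subgradient at [a2] given by the optimality condition of the prox step from [a0], [a1] to
    [a2]. *)
Definition step_subgrad (R : realType) (n : nat) (F : 'rV[R]_n -> 'rV[R]_n)
    (alpha gamma : R) (a0 a1 a2 : 'rV[R]_n) : 'rV[R]_n :=
  gamma^-1 *: (a1 - a2) - ((1 + alpha) *: F a1 - alpha *: F a0).

Lemma subdiff_fine (R : realType) (n : nat) (g : 'rV[R]_n -> \bar R)
    (a s b : 'rV[R]_n) :
  g a \is a fin_num -> g b \is a fin_num -> subdiff g a s ->
  fine (g a) + dotv s (b - a) <= fine (g b).
Proof.
by move=> ga gb /(_ b); rewrite -{1}(fineK ga) -{1}(fineK gb) -EFinD lee_fin.
Qed.

Lemma zer_opT (R : realType) (n : nat) (F : 'rV[R]_n -> 'rV[R]_n)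
    (g : 'rV[R]_n -> \bar R) (p : 'rV[R]_n) :
  zer (opT F g) p <-> subdiff g p (- F p).
Proof.
split=> [[v gv /eqP]|gp]; last by exists (- F p); rewrite ?subrr.
by rewrite addrC addr_eq0 => /eqP <-.
Qed.

(** The subgradient [- F p] gives the bound with [F p] in place of [F a]; monotonicity exchanges the
    two. *)
Lemma gap_ge0 (R : realType) (n : nat) (F : 'rV[R]_n -> 'rV[R]_n)
    (g : 'rV[R]_n -> \bar R) (a p : 'rV[R]_n) :
  monotone_op F -> g a \is a fin_num -> g p \is a fin_num ->
  zer (opT F g) p -> 0 <= gap F g a p.
Proof.
move=> Fm ga gp /zer_opT/(subdiff_fine gp ga); have := Fm a p.
by rewrite /gap -(opprB a p) !(dotvDl, dotvNl, dotvNr); lra.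
Qed.

Lemma dotv_lipschitz (R : realType) (n : nat) (F : 'rV[R]_n -> 'rV[R]_n) (L : R)
    (a b : 'rV[R]_n) :
  0 <= L -> enorm_lipschitz L F ->
  dotv (F a - F b) (F a - F b) <= L ^+ 2 * dotv (a - b) (a - b).
Proof.
move=> L0 FL; rewrite -!enorm_sqr -exprMn ler_pXn2r ?nnegrE ?enorm_ge0//.
by rewrite mulr_ge0 ?enorm_ge0.
Qed.

(** Finiteness of [g a1] is assumed separately because [a1] may be the starting point [x^0]. *)
Lemma lyapunov_descent (R : realType) (n : nat) (F : 'rV[R]_n -> 'rV[R]_n)
    (g : 'rV[R]_n -> \bar R) (alpha gamma L : R) (a0 a1 a2 a3 p : 'rV[R]_n) :
  2^-1 < alpha -> 0 < gamma -> monotone_op F -> 0 <= L -> enorm_lipschitz L F ->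
  proper_fun g -> g a1 \is a fin_num -> g p \is a fin_num ->
  subdiff g a2 (step_subgrad F alpha gamma a0 a1 a2) ->
  subdiff g a3 (step_subgrad F alpha gamma a1 a2 a3) ->
  lyapunov F g alpha gamma a1 a2 a3 p + gamma * gap F g a1 p
  + C_alpha alpha * (c_alpha alpha ^+ 2 - (gamma * L) ^+ 2)
    * dotv (a2 - a1) (a2 - a1)
  <= lyapunov F g alpha gamma a0 a1 a2 p.
Proof.
move=> a12 g0 Fm L0 FL gprop ga1 gpfin s2 s3.
have ga2 := subdiff_fin_num gprop s2; have ga3 := subdiff_fin_num gprop s3.
have := @descent_increments R n alpha gamma L (a2 - p) (a2 - a1) (a3 - a2)
  (F a2) (F a2 - F a1) (F a1 - F a0)
  (fine (g a2)) (fine (g a3)) (fine (g p)) (fine (g a1)) a12 g0.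
rewrite !subKr -!(scalerN gamma^-1) (opprB a3 a2) (opprB a2 a1).
have -> : a2 - p + (a3 - a2) = a3 - p by rewrite addrC subrKA.
rewrite (opprB a3 p).
have -> : a2 - p + (a1 - a2) = a1 - p by rewrite addrC subrKA.
rewrite -/(step_subgrad F alpha gamma a1 a2 a3).
rewrite -/(step_subgrad F alpha gamma a0 a1 a2).
have dotvB a : dotv (F a) (a - p) = - dotv (F a) (p - a) by rewrite -dotvNr opprB.
rewrite !dotvB -/(gap F g a2 p) -/(gap F g a1 p).
by apply; do ?[exact: subdiff_fine|exact: Fm|exact: dotv_lipschitz].
Qed.

(** * Tools for limits of the iterates *)

Lemma telescoping_cvg0 (R : realType) (u e : nat -> R) :
  (forall k, 0 <= u k) -> (forall k, 0 <= e k) ->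
  (forall k, u k.+1 + e k <= u k) -> e @ \oo --> (0 : R).
Proof.
move=> u0 e0 ue.
have ui : nonincreasing_seq u.
  apply/nonincreasing_seqP => k; have := ue k; have := e0 k; lra.
have /cvg_ex[l ul] : cvgn u.
  by apply: nonincreasing_is_cvgn => //; exists 0 => _ [k _ <-].
have d0 : (fun k => u k - u k.+1) @ \oo --> (0 : R).
  rewrite -(subrr l); apply: cvgB => //.
  by rewrite (cvg_shiftS u).
apply: (squeeze_cvgr _ (cvg_cst 0) d0).
by apply: nearW => k; rewrite e0 /=; have := ue k; lra.
Qed.

Lemma cvg_sqr_le (R : realType) (n : nat) (T : Type) (G : set_system T)
    {FG : ProperFilter G} (u : T -> 'rV[R]_n) (M : R) (e : T -> R) :
  e @ G --> (0 : R) -> (forall t, dotv (u t) (u t) <= M * e t) ->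
  u @ G --> (0 : 'rV[R]_n).
Proof.
move=> e0 ue; apply: cvg_dotv0.
have Me : (fun t => M * e t) @ G --> (0 : R).
  by rewrite -(mulr0 M); apply: cvgM => //; exact: cvg_cst.
apply: (squeeze_cvgr _ (cvg_cst 0) Me).
by apply: nearW => t; rewrite dotvv_ge0 ue.
Qed.

(** Closedness of the graph of the subdifferential: the subgradient inequality at each [y] passes to
    the limit. *)
Lemma zer_cluster (R : realType) (n : nat) (F : 'rV[R]_n -> 'rV[R]_n)
    (g : 'rV[R]_n -> \bar R) (T : Type) (G : set_system T)
    (FG : ProperFilter G) (w s : T -> 'rV[R]_n) (q : 'rV[R]_n) :
  proper_fun g -> lower_semicontinuous g -> (forall t, subdiff g (w t) (s t)) ->
  w @ G --> q -> s @ G --> - F q -> zer (opT F g) q.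
Proof.
move=> gp glsc ws wq sq; apply/zer_opT => y; have [gNy _] := gp.
case gy : (g y) => [r| |]; [|exact: leey|by have := gNy y; rewrite gy].
rewrite -leeBrDr // -EFinB.
apply: (@lsc_le_lim _ _ _ G _ g w q (fun t => r - dotv (s t) (y - w t))) => //.
  apply: cvgB; first exact: cvg_cst.
  by apply: cvg_dotv => //; apply: cvgB => //; exact: cvg_cst.
by apply: nearW => t; rewrite EFinB leeBrDr // -gy; exact: ws.
Qed.

(** Written with [N + k] so that for a numeral [N] the index computes to a successor of [k]. *)
Lemma cvg_shiftl (X : ptopologicalType) (N : nat) (v : nat -> X)
    (l : set_system X) :
  (fun k => v (N + k)%N) @ \oo --> l <-> v @ \oo --> l.
Proof.
rewrite -[X in _ <-> X](cvg_shiftn N).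
by under [X in X @ _ --> l]funext do rewrite addnC.
Qed.

Lemma lyapunov_ge (R : realType) (n : nat) (F : 'rV[R]_n -> 'rV[R]_n)
    (g : 'rV[R]_n -> \bar R) (alpha gamma : R) (a0 a1 a2 p : 'rV[R]_n) :
  2^-1 < alpha -> 0 < gamma -> 0 <= gap F g a1 p ->
  dotv (a2 - p) (a2 - p) <= 2 * lyapunov F g alpha gamma a0 a1 a2 p.
Proof.
move=> a12 g0 gap0; rewrite /lyapunov.
have := dotvv_ge0 (a2 - a1).
have : 0 <= lambda_alpha alpha * gamma ^+ 2 / 2
            * dotv (F a1 - F a0) (F a1 - F a0).
  rewrite mulr_ge0 ?dotvv_ge0// divr_ge0// mulr_ge0 ?sqr_ge0//.
  exact: lambda_alpha_ge0.
have : 0 <= (1 + alpha) * gamma * gap F g a1 p by rewrite !mulr_ge0//; lra.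
lra.
Qed.

(** * Convergence of the iterates *)

Section Convergence.
Context (R : realType) (n : nat) (F : 'rV[R]_n -> 'rV[R]_n)
  (g : 'rV[R]_n -> \bar R) (alpha gamma L : R) (z : nat -> 'rV[R]_n).
Hypotheses (F_mono : monotone_op F) (L_ge0 : 0 <= L) (F_lip : enorm_lipschitz L F)
  (g_proper : proper_fun g) (g_lsc : lower_semicontinuous g)
  (alpha_gt : 2^-1 < alpha) (gamma_gt0 : 0 < gamma)
  (gammaL : gamma * L < c_alpha alpha)
  (z_step : forall k, subdiff g (z k.+2)
     (step_subgrad F alpha gamma (z k) (z k.+1) (z k.+2))).

Let K := C_alpha alpha * (c_alpha alpha ^+ 2 - (gamma * L) ^+ 2).

Let K_gt0 : 0 < K.
Proof.
rewrite mulr_gt0 ?C_alpha_gt0// subr_gt0 ltr_pXn2r// nnegrE; last first.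
  by rewrite ltW// c_alpha_gt0.
by rewrite mulr_ge0// ltW.
Qed.

(** The indices start where the gap is taken at [z 2], the first point produced by a prox step, so
    [g] is finite there. *)
Let lyap (p : 'rV[R]_n) k :=
  lyapunov F g alpha gamma (z k.+1) (z k.+2) (z k.+3) p.
Let dec (p : 'rV[R]_n) k := gamma * gap F g (z k.+2) p
  + K * dotv (z k.+3 - z k.+2) (z k.+3 - z k.+2).

Let zfin k : g (z k.+2) \is a fin_num.
Proof. exact: subdiff_fin_num g_proper (z_step k). Qed.

Section Solution.
Context (p : 'rV[R]_n).
Hypothesis p_zer : zer (opT F g) p.

Let pfin : g p \is a fin_num.
Proof. by move/zer_opT : p_zer; exact: subdiff_fin_num. Qed.

Let gap0 k : 0 <= gap F g (z k.+2) p.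
Proof. exact: gap_ge0 (zfin k) pfin p_zer. Qed.

Let lyap_dec k : lyap p k.+1 + dec p k <= lyap p k.
Proof. by rewrite /dec addrA; apply: lyapunov_descent . Qed.

Let dec_ge0 k : 0 <= dec p k.
Proof. by apply: addr_ge0; rewrite mulr_ge0 ?dotvv_ge0// ltW. Qed.

Let lyap_dist k : dotv (z k.+3 - p) (z k.+3 - p) <= 2 * lyap p k.
Proof. exact: lyapunov_ge. Qed.

Let lyap_nonincr : nonincreasing_seq (lyap p).
Proof.
apply/nonincreasing_seqP => k; have := lyap_dec k; have := dec_ge0 k; lra.
Qed.

Let dec_cvg0 : dec p @ \oo --> (0 : R).
Proof.
apply: (@telescoping_cvg0 _ (lyap p)) => // k.
by have := lyap_dist k; have := dotvv_ge0 (z k.+3 - p); lra.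
Qed.

Lemma step_cvg0 : (fun k => z k.+1 - z k) @ \oo --> (0 : 'rV[R]_n).
Proof.
suff : (fun k => z k.+3 - z k.+2) @ \oo --> (0 : 'rV[R]_n).
  by move/(cvg_shiftl 2 (fun k => z k.+1 - z k)).
apply: (cvg_sqr_le (M := K^-1) dec_cvg0) => k.
rewrite mulrC ler_pdivlMr// mulrC /dec lerDr.
by rewrite mulr_ge0// ltW.
Qed.

Lemma F_step_cvg0 : (fun k => F (z k.+1) - F (z k)) @ \oo --> (0 : 'rV[R]_n).
Proof.
apply: (cvg_sqr_le (M := L ^+ 2) (cvg0_dotv step_cvg0)) => k.
exact: dotv_lipschitz.
Qed.

Lemma iterates_bounded : exists M, forall k, `|z k.+3| <= M.
Proof.
exists (Num.sqrt (2 * lyap p 0) + `|p|) => k.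
rewrite -[z k.+3](subrK p); apply: le_trans (ler_normD _ _) _; rewrite lerD2r.
apply: le_trans (normr_le_enorm _) _; rewrite /enorm ler_wsqrtr//.
by apply: le_trans (lyap_dist k) _; rewrite ler_pM2l//; exact: lyap_nonincr.
Qed.

Lemma cluster_cvg (G : set_system nat) (FG : ProperFilter G) :
  \oo `<=` G -> (fun k => z k.+3) @ G --> p -> z @ \oo --> p.
Proof.
move=> ooG zp.
have ooGcvg (X : topologicalType) (v : nat -> X) (l : X) :
  v @ \oo --> l -> v @ G --> l by move=> vl; apply: cvg_trans (cvg_app _ ooG) vl.
have zp0 : (fun k => z k.+3 - p) @ G --> (0 : 'rV[R]_n).
  by rewrite -(subrr p); apply: cvgB => //; exact: cvg_cst.
have s2 : (fun k => z k.+3 - z k.+2) @ \oo --> (0 : 'rV[R]_n).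
  exact/(cvg_shiftl 2 (fun k => z k.+1 - z k))/step_cvg0.
have F1 : (fun k => F (z k.+2) - F (z k.+1)) @ \oo --> (0 : 'rV[R]_n).
  exact/(cvg_shiftl 1 (fun k => F (z k.+1) - F (z k)))/F_step_cvg0.
have gap_cvg0 : (fun k => gap F g (z k.+2) p) @ \oo --> (0 : R).
  have d0 : (fun k => gamma^-1 * dec p k) @ \oo --> (0 : R).
    by rewrite -(mulr0 gamma^-1); apply: cvgM => //; exact: cvg_cst.
  apply: (squeeze_cvgr _ (cvg_cst 0) d0); apply: nearW => k.
  rewrite gap0 /= mulrC ler_pdivlMr// mulrC /dec lerDl.
  by rewrite mulr_ge0 ?dotvv_ge0// ltW.
have lyap0 : lyap p @ G --> (0 : R).
  have -> : 0 = 2^-1 * 0 + 2^-1 * 0 + lambda_alpha alpha * gamma ^+ 2 / 2 * 0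
                + (1 + alpha) * gamma * 0 :> R by ring.
  (* Only the distance term needs [G]; the other three vanish along [\oo]. *)
  apply: cvgD; [apply: cvgD; [apply: cvgD|]|]; apply: cvgM; try exact: cvg_cst.
  - exact: cvg0_dotv.
  - by apply: ooGcvg; exact: cvg0_dotv.
  - by apply: ooGcvg; exact: cvg0_dotv.
  - exact: ooGcvg.
apply/(cvg_shiftl 3).
apply/subr_cvg0; apply: cvg_dotv0; apply/cvgr0Pnorm_le => e e0.
(* One small value is enough: [lyap p] is nonincreasing and dominates half the squared distance to
   [p]. *)
have [k0 k0e] : exists k0, lyap p k0 < e / 2.
  apply: (@filter_ex _ _ FG); move/cvgr_lt : lyap0; apply.
  by rewrite divr_gt0.
exists k0 => // k /= k0k; rewrite ger0_norm ?dotvv_ge0//.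
have := lyap_dist k; have := lyap_nonincr k0k; lra.
Qed.

End Solution.

Lemma iterates_cvg :
  zer (opT F g) !=set0 -> exists2 q, zer (opT F g) q & z @ \oo --> q.
Proof.
move=> [p pz]; have [M zM] := iterates_bounded pz.
have [G [q [FG ooG zq]]] := bounded_ultra_cvg zM.
suff qz : zer (opT F g) q by exists q => //; exact: (cluster_cvg qz FG ooG).
have ooGcvg (v : nat -> 'rV[R]_n) (l : 'rV[R]_n) : v @ \oo --> l -> v @ G --> l.
  by move=> vl; apply: cvg_trans (cvg_app _ ooG) vl.
have d0 := step_cvg0 pz; have F0 := F_step_cvg0 pz.
pose w k := z k.+3.
pose d k := z k.+3 - z k.+2.
pose A k := F (z k.+3) - F (z k.+2).
pose B k := F (z k.+2) - F (z k.+1).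
have dG : d @ G --> (0 : 'rV[R]_n).
  exact/ooGcvg/(cvg_shiftl 2 (fun k => z k.+1 - z k)).
have AG : A @ G --> (0 : 'rV[R]_n).
  exact/ooGcvg/(cvg_shiftl 2 (fun k => F (z k.+1) - F (z k))).
have BG : B @ G --> (0 : 'rV[R]_n).
  exact/ooGcvg/(cvg_shiftl 1 (fun k => F (z k.+1) - F (z k))).
have FwG : (fun k => F (w k)) @ G --> F q.
  apply/subr_cvg0; move/subr_cvg0 : zq => /cvg0_dotv wq.
  by apply: (cvg_sqr_le (M := L ^+ 2) wq) => k; exact: dotv_lipschitz.
pose s k := step_subgrad F alpha gamma (z k.+1) (z k.+2) (z k.+3).
apply: (@zer_cluster _ _ F g _ G FG w s) => //.
  by move=> k; exact: z_step.
(* In terms of the vanishing increments the limit [- F q] of [s] is visible. *)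
have -> : s = fun k => gamma^-1 *: (- d k) - (F (w k) - A k + alpha *: B k).
  apply/funext => k; rewrite /s /step_subgrad /d /A /B /w.
  by apply/rowP => i; rewrite !mxE; ring.
have -> : - F q = gamma^-1 *: (- 0) - (F q - 0 + alpha *: 0).
  by rewrite !oppr0 !scaler0 !addr0 sub0r.
apply: cvgB; first by apply: cvgZr; exact: cvgN.
by apply: cvgD; [exact: cvgB|exact: cvgZr].
Qed.

End Convergence.

(** * Return to extended-real quantities and the theorem *)

Lemma VE (R : realType) (n : nat) (F : 'rV[R]_n -> 'rV[R]_n)
    (g : 'rV[R]_n -> \bar R) (x : int -> 'rV[R]_n) (k : int) (p : 'rV[R]_n) :
  g (x k) \is a fin_num -> g p \is a fin_num -> V F g x k p = (gap F g (x k) p)%:E.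
Proof. by move=> gx gp; rewrite /V -(fineK gx) -(fineK gp) -!EFinB. Qed.

Lemma UE (R : realType) (n : nat) (F : 'rV[R]_n -> 'rV[R]_n)
    (g : 'rV[R]_n -> \bar R) (alpha gamma : R) (x : int -> 'rV[R]_n) (k : int)
    (p : 'rV[R]_n) :
  g (x (k - 1)) \is a fin_num -> g p \is a fin_num ->
  U F g alpha gamma x k p
  = (lyapunov F g alpha gamma (x (k - 2)) (x (k - 1)) (x k) p)%:E.
Proof.
by move=> gx gp; rewrite /U VE// -EFinM -EFinD !enorm_sqr.
Qed.

Theorem theorem2p2 (R : realType) (n : nat)
    (F : 'rV[R]_n -> 'rV[R]_n) (g : 'rV[R]_n -> \bar R)
    (F_mono : monotone_op F)
    (F_loclip : [locally [lipschitz F p | p in setT]])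
    (g_proper : proper_fun g) (g_convex : econvex g)
    (g_lsc : lower_semicontinuous g)
    (zerT_neq0 : zer (opT F g) !=set0)
    (L_F : R) (L_F_ge0 : 0 <= L_F) (F_lip : enorm_lipschitz L_F F)
    (alpha : R) (alpha_gt : 2^-1 < alpha)
    (gamma : R) (gamma_gt0 : 0 < gamma) (gammaL : gamma * L_F < c_alpha alpha)
    (x : int -> 'rV[R]_n)
    (x_rec : forall k : nat,
       x (k%:Z + 1) =
       prox gamma g (x k%:Z - gamma *: ((1 + alpha) *: F (x k%:Z)
                                        - alpha *: F (x (k%:Z - 1))))) :
  (exists2 xs, zer (opT F g) xs & x k%:Z @[k --> \oo] --> xs) /\
  0 < C_alpha alpha /\
  (forall xs, zer (opT F g) xs -> forall k : nat, (1 <= k)%N ->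
     (U F g alpha gamma x (k%:Z + 1)%R xs
      + gamma%:E * V F g x (k%:Z - 1)%R xs
      + (C_alpha alpha * (c_alpha alpha ^+ 2 - (gamma * L_F) ^+ 2)
         * enorm (x k%:Z - x (k%:Z - 1)) ^+ 2)%:E
      <= U F g alpha gamma x k%:Z xs)%E).

Proof.
have [p0 p0z] := zerT_neq0; have p0s := (zer_opT F g p0).1 p0z.
have intS1 (k : nat) : k.+1%:Z = k%:Z + 1 by rewrite -addn1 PoszD.
(* Shift by one: [z 0] is the extra starting point [x^(-1)]. *)
pose z (k : nat) := x (k%:Z - 1).
have xz (k : nat) : x k%:Z = z k.+1 by rewrite /z intS1 addrK.
have z_step k : subdiff g (z k.+2) (step_subgrad F alpha gamma (z k) (z k.+1) (z k.+2)).
  rewrite -!xz intS1 x_rec -/(z k).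
  set y := _ - gamma *: _.
  have := prox_subdiff y gamma_gt0 g_proper g_convex g_lsc p0s.
  congr (subdiff g _ _); rewrite /step_subgrad -[RHS]/(_ - _).
  rewrite -[X in _ - X](scalerK (lt0r_neq0 gamma_gt0)) -scalerBr.
  by rewrite /y addrAC.
have zfin k : g (z k.+2) \is a fin_num.
  exact: subdiff_fin_num g_proper (z_step k).
split; last split.
- have [q qz zq] := iterates_cvg F_mono L_F_ge0 F_lip g_proper g_lsc alpha_gt
    gamma_gt0 gammaL z_step zerT_neq0.
  exists q => //; under eq_cvg do rewrite xz.
  exact/(cvg_shiftl 1 z).
- exact: C_alpha_gt0.
move=> p pz [//|k] _; have ps := (zer_opT F g p).1 pz.
have pfin := subdiff_fin_num g_proper ps.
have intS1' (j : nat) : j.+1%:Z - 1 = j by rewrite intS1 addrK.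
have intS2' (j : nat) : j.+1%:Z - 2 = j%:Z - 1.
  by rewrite intS1 -[2]/(1 + 1) opprD addrA addrK.
rewrite -intS1 intS1'.
(* The step in question is now [k + 1]. For [k = 0] the point [x^0] may lie outside the domain of
   [g]; the right-hand side is then [+oo]. *)
case gxk : (g (x k)) => [r| |].
- have xkfin : g (x k) \is a fin_num by rewrite gxk.
  have xSfin : g (x k.+1) \is a fin_num by rewrite xz.
  rewrite !UE ?intS1'// VE// !intS2' intS1' -EFinM -!EFinD lee_fin enorm_sqr.
  apply: lyapunov_descent => //; last by rewrite !xz.
  have := z_step k; rewrite -!xz; exact.
- suff -> : U F g alpha gamma x k.+1 p = +oo%E by exact: leey.
  rewrite /U /V intS1' gxk -(fineK pfin) !addye// gt0_muley ?addey//.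
  by rewrite lte_fin mulr_gt0//; lra.
- by have := g_proper.1 (x k); rewrite gxk.
Qed.
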